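(* Assume that $g\equiv 0$ and that $f$ satisfies the quadratic functional growth condition, i.e. there is $\mu>0$ with $$f(x)-f(\overline{x})\ge\frac{\mu}{2}\|x-\overline{x}\|^2\qquad\forall x\in\operatorname{dom}F,$$ and has Lipschitz continuous gradient. Assume further that there exists $q<1$ such that the iterates $(x_t)_{t\ge0}$ of the stochastic first order (SFO) methods, i.e. SPG or SPP, with constant stepsize $\gamma>0$ converge linearly, i.e. $$\mathbf{E}_{\xi_t}\left[\|x_{t+1}-\overline{x}_{t+1}\|^2\,\middle|\,\xi_{[t-1]}\right]\le q\,\|x_t-\overline{x}_t\|^2\qquad\forall t\ge0,$$ and that the stochastic process $(x_t)_{t\ge0}$ yields the same projection onto the optimal set, i.e. $\overline{x}_t=\overline{x}_0$ for all $t\ge0$ almost surely. Then the stochastic bounded gradient condition holds with $B=0$, i.e. there is $L\ge0$ such that $$L\,(F(x)-F(\overline{x}))\ge\mathbf{E}_\xi\left[\|\nabla F(x,\xi)\|^2\right]\qquad\forall x\in\operatorname{dom}F$$ (where $F=f$ and $\nabla F(x,\xi)=\nabla f(x,\xi)$ since $g\equiv0$), or equivalently, all the partial functions $f(\cdot,\xi)$ must have the same minimizer.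
   Context: Problem: $f,g:\mathbb{R}^m\times\Omega\to\bar{\mathbb{R}}$ (extended real values) are proper and convex in the first argument, $\Omega$ is endowed with a probability distribution $\mathbf{P}$, $\xi\in\Omega$ is a random variable with this distribution, $f(x)=\mathbf{E}[f(x,\xi)]$, $g(x)=\mathbf{E}[g(x,\xi)]$, $F(x,\xi)=f(x,\xi)+g(x,\xi)$ and $F(x)=f(x)+g(x)$, with expectations finite for all $x\in\operatorname{dom}F$. $X^*$ is the optimal set of the convex problem $\min_{x\in\mathbb{R}^m}F(x)$; for $x\in\mathbb{R}^m$, $\overline{x}=\Pi_{X^*}(x)$ is the projection of $x$ onto $X^*$ (so $\overline{x}_t=\Pi_{X^*}(x_t)$). $\nabla f(x,\xi)\in\partial f(x,\xi)$ denotes the gradient or a subgradient of $f(\cdot,\xi)$ at $x$, and these are unbiased: $\mathbf{E}[\nabla f(x,\xi)]\in\partial f(x)$. The stochastic bounded gradient condition, in general, asks for constants $L\ge0$, $B\ge0$ with $B^2+L(F(x)-F(\overline{x}))\ge\mathbf{E}_\xi[\|\nabla F(x,\xi)\|^2]$ for all $x\in\operatorname{dom}F$. Algorithms (written for $g\equiv0$ and constant stepsize $\gamma$): let $(\xi_t)_{t\ge0}$ be an i.i.d. sequence distributed as $\xi$ and $x_0\in\mathbb{R}^m$. SPG (stochastic proximal gradient, which for $g\equiv0$ is stochastic gradient descent): $x_{t+1}=x_t-\gamma\nabla f(x_t,\xi_t)$. SPP (stochastic proximal point): $x_{t+1}=\operatorname{prox}_{\gamma f(\cdot,\xi_t)}(x_t)=\arg\min_{y\in\mathbb{R}^m}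 f(y,\xi_t)+\frac{1}{2\gamma}\|y-x_t\|^2$. $\xi_{[t]}=\{\xi_0,\dots,\xi_t\}$ denotes the history, and $\mathbf{E}_{\xi_t}[\cdot\mid\xi_{[t-1]}]$ is the conditional expectation given $\xi_{[t-1]}$ (expectation over $\xi_0$ for $t=0$).
   Formalization: For SPP the partial functions f(·,ξ) are also assumed to have Lipschitz gradients with constants L(ξ), E[L(ξ)²]<∞; with smoothness of f(x)=E f(x,ξ) alone the claim fails: f(x,ξ)=ξx²/2, ξ>0, Eξ<∞, Eξ²=∞. *)

(* Defs.v *)
From HB Require Import structures.
From mathcomp Require Import all_boot all_order all_algebra.
From mathcomp Require Import all_classical all_reals all_analysis.
From mathcomp Require Import measurable_realfun.

Set Implicit Arguments.
Unset Strict Implicit.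
Unset Printing Implicit Defensive.

Import Order.TTheory GRing.Theory Num.Theory.
Import numFieldNormedType.Exports.

Local Open Scope classical_set_scope.
Local Open Scope ring_scope.
Local Open Scope ereal_scope.

Section Euclidean.
Context {R : realType} {m : nat}.
Implicit Types (x y p v : 'rV[R]_m) (X : set 'rV[R]_m) (phi : 'rV[R]_m -> \bar R).

Definition dot x y : R := (\sum_(i < m) x ord0 i * y ord0 i)%R.

(* The library's norm on 'rV[R]_m is the sup norm, hence this one. *)
Definition enorm x : R := Num.sqrt (dot x x).

Definition is_projection X x p : Prop :=
  X p /\ forall y, X y -> (enorm (x - p) <= enorm (x - y))%R.

Definition edom phi : set 'rV[R]_m := [set x | phi x < +oo].

Definition proper phi : Prop :=
  (forall x, -oo < phi x) /\ exists x, phi x < +oo.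

(* The weights are taken in ]0, 1[, so that 0 * +oo never occurs. *)
Definition econvex phi : Prop := forall x y (t : R), (0 < t < 1)%R ->
  phi (t *: x + (1 - t) *: y)%R <= t%:E * phi x + (1 - t)%:E * phi y.

Definition argmin phi : set 'rV[R]_m :=
  [set x | phi x < +oo /\ forall y, phi x <= phi y].

Definition subdiff phi x : set 'rV[R]_m :=
  [set v | phi x \is a fin_num /\
           forall y, phi x + (dot v (y - x)%R)%:E <= phi y].

(* Frechet differentiability of an extended-valued function: phi has to be
   finite around x, so that the junk values of fine play no role.  The notion
   does not depend on the choice of a norm on 'rV[R]_m. *)
Definition is_gradient phi x v : Prop :=
  [/\ \forall y \near x, phi y \is a fin_num,
      differentiable (fun y => fine (phi y)) x
    & forall h, 'd (fun y => fine (phi y)) x h = dot v h].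

Definition lipschitz_gradient phi (L : R) : Prop :=
  (0 <= L)%R /\ exists D : 'rV[R]_m -> 'rV[R]_m,
    (forall x, edom phi x -> is_gradient phi x (D x)) /\
    (forall x y, edom phi x -> edom phi y ->
       (enorm (D x - D y) <= L * enorm (x - y))%R).

(* y = prox_{gamma phi}(x); the minimizer is unique when phi is convex and
   proper and gamma > 0. *)
Definition is_prox (gamma : R) phi x y : Prop := forall z,
  phi y + ((2 * gamma)^-1 * enorm (y - x) ^+ 2)%:E
  <= phi z + ((2 * gamma)^-1 * enorm (z - x) ^+ 2)%:E.

Definition quadratic_growth phi (proj : 'rV[R]_m -> 'rV[R]_m) (mu : R) : Prop :=
  forall x, edom phi x ->
    (mu / 2 * enorm (x - proj x) ^+ 2)%:E <= phi x - phi (proj x).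

End Euclidean.

Section StochasticObjective.
Context {R : realType} {d : measure_display} {Om : measurableType d}.
Context {m : nat} (P : probability Om R).
Implicit Types (f : 'rV[R]_m -> Om -> \bar R) (G : 'rV[R]_m -> Om -> 'rV[R]_m).

Definition expected f : 'rV[R]_m -> \bar R := fun x => \int[P]_w f x w.

Definition stochastic_convex_objective f : Prop :=
  [/\ forall w, proper (f ^~ w),
      forall w, econvex (f ^~ w),
      forall x, measurable_fun setT (f x)
    & forall x, edom (expected f) x -> P.-integrable setT (f x)].

(* G x w plays the role of the (sub)gradient of f(., w) at x.  "Almost every w"
   cannot be replaced by "every w": at a point of the domain of the expectation
   f(., w) may be infinite, and have no subgradient, on a null set. *)
Definition unbiased_subgradient f G : Prop :=
  forall x, edom (expected f) x ->
    [/\ {ae P, forall w, subdiff (f ^~ w) x (G x w)},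
        forall i, P.-integrable setT (fun w => (G x w ord0 i)%:E)
      & subdiff (expected f) x
          (\row_(i < m) fine (\int[P]_w (G x w ord0 i)%:E))].

Definition stochastic_bounded_gradient f G (proj : 'rV[R]_m -> 'rV[R]_m)
    (L B : R) : Prop :=
  forall x, edom (expected f) x ->
    \int[P]_w (enorm (G x w) ^+ 2)%:E
    <= (B ^+ 2)%:E + L%:E * (expected f x - expected f (proj x)).

Definition partials_lipschitz_gradient f : Prop :=
  exists L : Om -> R,
    P.-integrable setT (fun w => (L w ^+ 2)%:E) /\
    {ae P, forall w, lipschitz_gradient (f ^~ w) (L w)}.

Definition same_minimizer f : Prop :=
  exists z, {ae P, forall w, argmin (f ^~ w) z}.

End StochasticObjective.

Section Processes.
Context {R : realType} {d d' : measure_display}.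
Context {Om : measurableType d} {S : measurableType d'} {m : nat}.
Context (Pr : probability S R).
Implicit Types (xi : nat -> S -> Om) (x : nat -> S -> 'rV[R]_m).

(* Taking some of the A i to be setT, one obtains the product rule for every
   finite subfamily. *)
Definition iid xi (P : probability Om R) : Prop :=
  [/\ forall t, measurable_fun setT (xi t),
      forall t (A : set Om), measurable A -> Pr (xi t @^-1` A) = P A
    & forall n (A : nat -> set Om), (forall i, measurable (A i)) ->
        Pr (\big[setI/setT]_(i < n) (xi i @^-1` A i)) =
        \prod_(i < n) Pr (xi i @^-1` A i)].

(* The sigma-algebra generated by xi_0, ..., xi_(t-1); trivial for t = 0. *)
Definition history xi (t : nat) : set (set S) :=
  <<s [set B | exists i (A : set Om),
         [/\ (i < t)%N, measurable A & B = xi i @^-1` A]] >>.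

(* C is a version of the conditional expectation, given the sigma-algebra H,
   of the nonnegative random variable Y. *)
Definition is_cond_expectation (H : set (set S)) (Y C : S -> \bar R) : Prop :=
  [/\ measurable_fun setT Y,
      forall s, 0 <= C s,
      forall B, measurable B -> H (C @^-1` B)
    & forall A, H A -> \int[Pr]_(s in A) C s = \int[Pr]_(s in A) Y s].

Inductive sfo_method := SPG | SPP.

Definition sfo_step (meth : sfo_method) (f : 'rV[R]_m -> Om -> \bar R)
    (G : 'rV[R]_m -> Om -> 'rV[R]_m) (gamma : R)
    (w : Om) (y y' : 'rV[R]_m) : Prop :=
  match meth with
  | SPG => y' = (y - gamma *: G y w)%R
  | SPP => is_prox gamma (f ^~ w) y y'
  end.

Definition sfo_iterates meth f G gamma xi (x0 : 'rV[R]_m) x : Prop :=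
  [/\ forall t i, measurable_fun setT (fun s => x t s ord0 i),
      forall s, x 0%N s = x0
    & forall t s, sfo_step meth f G gamma (xi t s) (x t s) (x t.+1 s)].

Definition linear_convergence xi (proj : 'rV[R]_m -> 'rV[R]_m) (q : R) x : Prop :=
  forall t, exists C : S -> \bar R,
    is_cond_expectation (history xi t)
      (fun s => (enorm (x t.+1 s - proj (x t.+1 s)) ^+ 2)%:E) C /\
    {ae Pr, forall s, C s <= (q * enorm (x t s - proj (x t s)) ^+ 2)%:E}.

Definition same_projection (proj : 'rV[R]_m -> 'rV[R]_m) x : Prop :=
  {ae Pr, forall s, forall t, proj (x t s) = proj (x 0%N s)}.

End Processes.

(* Main.v *)
Require Import Defs.
From HB Require Import structures.
From mathcomp Require Import all_boot all_order all_algebra.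
From mathcomp Require Import all_classical all_reals all_analysis.
From mathcomp Require Import measurable_realfun.
From mathcomp Require Import ring lra.
Import Order.TTheory GRing.Theory Num.Theory.
Import numFieldNormedType.Exports.
Local Open Scope classical_set_scope.
Local Open Scope ring_scope.

(** One step of the method, started at an arbitrary point x of the domain, is
    enough.  Let p be the projection of x.  The linear convergence at time 0 and
    the constancy of the projection give E |x_1 - p|^2 <= q |x - p|^2
    (lemma first_step_contraction).

    For the gradient method, gamma G(x, xi_0) = (x - p) - (x_1 - p), so that
    gamma^2 E |G(x, xi)|^2 <= 2 (1 + q) |x - p|^2 <= 4 |x - p|^2
    (lemma spg_subgradient_bound).

    For the proximal point method the step is started at p instead of x: the
    bound then is 0, hence x_1 = p almost surely and p is a fixed point of almost
    every proximal map.  The gradient of almost every partial function thus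
    vanishes at p (lemma spp_subgradient_eq0), and the Lipschitz continuity of
    the partial gradients gives E |G(x, xi)|^2 <= E [L(xi)^2] |x - p|^2
    (lemma lipschitz_subgradient_bound).

    In both cases E |G(x, xi)|^2 <= K |x - p|^2 with K independent of x, and
    quadratic growth bounds |x - p|^2 by (2 / mu) (f x - f p): this is the
    stochastic bounded gradient condition with B = 0.  At x = p it says that
    G(p, xi) = 0 almost surely, so that p minimizes almost every partial
    function (lemma same_minimizer_of_bounded_gradient). *)

Set Implicit Arguments.
Unset Strict Implicit.
Unset Printing Implicit Defensive.

(** * Euclidean norm and subgradients *)

Section EuclideanNorm.
Context {R : realType} {m : nat}.
Implicit Types (x y v D : 'rV[R]_m) (phi : 'rV[R]_m -> \bar R).

Lemma sqr_enorm x : enorm x ^+ 2 = dot x x.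
Proof. by rewrite /enorm sqr_sqrtr// sumr_ge0// => i _; rewrite -expr2 sqr_ge0. Qed.

Lemma enorm_ge0 x : 0 <= enorm x.
Proof. exact: sqrtr_ge0. Qed.

Lemma dotBl x y v : dot (x - y) v = dot x v - dot y v.
Proof. by rewrite /dot -sumrB; apply: eq_bigr => i _; rewrite !mxE mulrBl. Qed.

Lemma dotZr x v a : dot x (a *: v) = a * dot x v.
Proof. by rewrite /dot mulr_sumr; apply: eq_bigr => i _; rewrite mxE mulrCA. Qed.

Lemma sqr_enormZ a x : enorm (a *: x) ^+ 2 = a ^+ 2 * enorm x ^+ 2.
Proof.
by rewrite !sqr_enorm /dot mulr_sumr; apply: eq_bigr => i _; rewrite mxE; ring.
Qed.

Lemma sqr_enorm_eq0 x : (enorm x ^+ 2 == 0) = (x == 0).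
Proof.
apply/eqP/eqP => [|->]; last first.
  by rewrite sqr_enorm /dot big1// => i _; rewrite mxE mul0r.
rewrite sqr_enorm => /eqP; rewrite psumr_eq0; last first.
  by move=> i _; rewrite -expr2 sqr_ge0.
move=> /allP x0; apply/rowP => i; rewrite mxE; apply/eqP.
by rewrite -sqrf_eq0 expr2; apply: x0; rewrite mem_index_enum.
Qed.

Lemma enorm0 : enorm (0 : 'rV[R]_m) = 0.
Proof. by apply/eqP; rewrite -sqrf_eq0 sqr_enorm_eq0. Qed.

Lemma sqr_enormB_le x y :
  enorm (x - y) ^+ 2 <= 2 * enorm x ^+ 2 + 2 * enorm y ^+ 2.
Proof.
rewrite !sqr_enorm /dot !mulr_sumr -big_split/=.
apply: ler_sum => i _; rewrite !mxE.
by have := sqr_ge0 (x ord0 i + y ord0 i); lra.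
Qed.

Lemma is_projection_id (X : set 'rV[R]_m) x p :
  X x -> is_projection X x p -> p = x.
Proof.
move=> Xx [_ /(_ _ Xx)]; rewrite subrr enorm0 => xp0.
apply/esym/eqP; rewrite -subr_eq0 -sqr_enorm_eq0 sqrf_eq0.
by rewrite eq_le xp0 enorm_ge0.
Qed.

(** The quadratic error vanishes to first order along the segment from x in the
    direction v - D, so the directional derivative dot D (v - D) is at least
    dot v (v - D), that is, the squared norm of v - D is nonpositive.  The error
    term is what makes the lemma cover proximal points as well as
    subgradients. *)
Lemma gradient_unique phi x v D c : is_gradient phi x D ->
  (forall y, phi x + (dot v (y - x))%:E
             <= phi y + (c * enorm (y - x) ^+ 2)%:E)%E ->
  D = v.
Proof.
move=> [fin_near dphi dphiE] phi_ge.
pose h := v - D; pose g y := fine (phi y).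
have quot_cvg : t^-1 *: (g (t *: h + x) - g x) @[t --> 0^'+] --> dot D h.
  apply: cvg_dnbhs_at_right; rewrite -dphiE -deriveE//.
  exact: (diff_derivable dphi).
have line_cvg : t *: h + x @[t --> (0 : R)^'+] --> x.
  apply: cvg_at_right_filter; rewrite -[X in _ --> X]add0r.
  apply: cvgD; last exact: cvg_cst.
  by rewrite -[X in _ --> X](scale0r h); apply: cvgZr_tmp; exact: cvg_id.
have bound_cvg : dot v h - t * (c * enorm h ^+ 2) @[t --> (0 : R)^'+] --> dot v h.
  apply: cvg_at_right_filter.
  rewrite -[X in _ --> X]subr0 -[X in _ - X](mul0r (c * enorm h ^+ 2)).
  apply: cvgB; first exact: cvg_cst.
  by apply: cvgMl; exact: cvg_id.
have phix : phi x \is a fin_num by exact: nbhs_singleton fin_near.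
suff vD : dot v h <= dot D h.
  apply/esym/eqP; rewrite -subr_eq0 -sqr_enorm_eq0 eq_le sqr_ge0 andbT.
  by rewrite sqr_enorm -/h {1}/h dotBl subr_le0.
apply: (ler_cvg_to bound_cvg quot_cvg).
near=> t.
have t0 : 0 < t by near: t; exact: nbhs_right_gt.
have phit : phi (t *: h + x) \is a fin_num by near: t; exact: (line_cvg _ fin_near).
have := phi_ge (t *: h + x); rewrite addrK -(fineK phix) -(fineK phit) lee_fin.
rewrite dotZr sqr_enormZ -/(g x) -/(g _) => gt.
rewrite /GRing.scale/= ler_pdivlMl//.
rewrite mulrBr; lra.
Unshelve. all: by end_near. Qed.

Lemma subdiff_edom phi x v : subdiff phi x v -> edom phi x.
Proof. by move=> [xfin _]; rewrite /edom /= ltey_eq xfin. Qed.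

Lemma subgradient_is_gradient phi x v D :
  is_gradient phi x D -> subdiff phi x v -> D = v.
Proof.
move=> Dgrad [_ vsub]; apply: (gradient_unique (c := 0) Dgrad) => y.
by rewrite mul0r adde0.
Qed.

(** A fixed point p of the proximal map satisfies phi p <= phi y + c |y - p|^2:
    the vector 0 is a subgradient at p up to a quadratic error, hence it is the
    gradient at p. *)
Lemma subgradient_eq0_at_prox phi g gamma L p :
  lipschitz_gradient phi L -> subdiff phi p g -> is_prox gamma phi p p -> g = 0.
Proof.
move=> [_ [D [Dgrad _]]] gsub pprox.
have Dp := Dgrad _ (subdiff_edom gsub).
rewrite -(subgradient_is_gradient Dp gsub).
apply: (gradient_unique (c := (2 * gamma)^-1) Dp) => y.
have := pprox y; rewrite subrr enorm0 expr0n mulr0 adde0.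
by rewrite /dot big1 ?adde0// => i _; rewrite mxE mul0r.
Qed.

Lemma lipschitz_subgradient phi L y z g h : lipschitz_gradient phi L ->
  subdiff phi y g -> subdiff phi z h -> enorm (g - h) <= L * enorm (y - z).
Proof.
move=> [_ [D [Dgrad Dlip]]] gsub hsub.
have ydom := subdiff_edom gsub; have zdom := subdiff_edom hsub.
rewrite -(subgradient_is_gradient (Dgrad _ ydom) gsub).
rewrite -(subgradient_is_gradient (Dgrad _ zdom) hsub).
exact: Dlip.
Qed.

End EuclideanNorm.

(** * Mean square and law of a sample *)

Lemma measurable_sqr_enorm {R : realType} {m : nat} {d : measure_display}
    {T : measurableType d} (h : T -> 'rV[R]_m) :
  (forall i, measurable_fun setT (fun s => h s ord0 i)) ->
  measurable_fun setT (fun s => (enorm (h s) ^+ 2)%:E).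
Proof.
move=> mh; apply/measurable_EFinP.
under eq_fun do rewrite sqr_enorm.
by apply: measurable_sum => i; exact: measurable_funM.
Qed.

Lemma integral_sqr_enorm_eq0 {R : realType} {m : nat} {d : measure_display}
    {T : measurableType d} (P : probability T R) (H : T -> 'rV[R]_m) :
  (forall i, measurable_fun setT (fun w => H w ord0 i)) ->
  (\int[P]_w (enorm (H w) ^+ 2)%:E <= 0)%E <-> {ae P, forall w, H w = 0}.
Proof.
move=> mH; have mH2 := measurable_sqr_enorm mH.
have -> : (\int[P]_w (enorm (H w) ^+ 2)%:E <= 0)%E <->
  (\int[P]_w `|(enorm (H w) ^+ 2)%:E| = 0)%E.
  under [in X in _ <-> X]eq_integral do rewrite gee0_abs ?lee_fin ?sqr_ge0//.
  split=> [H0|->//]; apply/eqP; rewrite eq_le H0/=.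
  by apply: integral_ge0 => w _; rewrite lee_fin sqr_ge0.
rewrite ae_eq_integral_abs//; split; apply: filterS => w.
  by move=> /(_ Logic.I)[] /eqP; rewrite sqr_enorm_eq0 => /eqP.
by move=> -> _; rewrite enorm0 expr0n.
Qed.

(** * First step of the methods and bounds on the stochastic subgradient *)

Section Stochastic.
Context {R : realType} {m : nat} {d d' : measure_display}.
Context {Om : measurableType d} {S : measurableType d'}.
Implicit Types (P : probability Om R) (Pr : probability S R).
Implicit Types (xi : nat -> S -> Om) (proj : 'rV[R]_m -> 'rV[R]_m).
Implicit Types (f : 'rV[R]_m -> Om -> \bar R) (G : 'rV[R]_m -> Om -> 'rV[R]_m).

Lemma integral_cst_probability Pr (r : \bar R) : (\int[Pr]_s r = r)%E.
Proof.
transitivity (r * Pr setT)%E; first exact: integral_cst.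
by rewrite probability_setT mule1.
Qed.

Lemma iid_integral P Pr xi t (h : Om -> \bar R) : iid Pr xi P ->
  measurable_fun setT h -> (forall w, 0 <= h w)%E ->
  (\int[P]_w h w = \int[Pr]_s h (xi t s))%E.
Proof.
move=> [mxi xiP _] mh h0.
rewrite (eq_measure_integral (pushforward Pr (xi t))).
  by rewrite (ge0_integral_pushforward (mxi t)).
by move=> A mA _; exact/esym/xiP.
Qed.

Lemma iid_ae P Pr xi t (Q : Om -> Prop) : iid Pr xi P ->
  {ae P, forall w, Q w} -> {ae Pr, forall s, Q (xi t s)}.
Proof.
move=> [mxi xiP _] [A [mA PA QA]].
exists (xi t @^-1` A); split.
- by rewrite -[X in measurable X]setTI; exact: mxi.
- by rewrite xiP.
- by move=> s /= ns; exact: QA.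
Qed.

Lemma history0_measurable xi (A : set S) : history xi 0 A -> measurable A.
Proof.
apply: smallest_sub; first exact: sigma_algebra_measurable.
by move=> B [i [? []]].
Qed.

Lemma iterate_shift_measurable meth f G gamma xi x0 x t p i :
  sfo_iterates meth f G gamma xi x0 x ->
  measurable_fun setT (fun s => (x t s - p) ord0 i).
Proof.
move=> [mx _ _]; under eq_fun do rewrite mxE.
by apply: measurable_funD; [exact: mx | exact: measurable_cst].
Qed.

(** Given the trivial sigma-algebra, the conditional expectation at time 0
    integrates to a plain expectation, and the almost sure identity
    proj (x 1) = proj x0 replaces the random projection of the first iterate by
    a fixed point. *)
Lemma first_step_contraction Pr meth f G gamma xi proj q x0 x :
  sfo_iterates meth f G gamma xi x0 x ->
  linear_convergence Pr xi proj q x -> same_projection Pr proj x ->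
  (\int[Pr]_s (enorm (x 1%N s - proj x0) ^+ 2)%:E
   <= (q * enorm (x0 - proj x0) ^+ 2)%:E)%E.
Proof.
move=> iter /(_ 0%N)[C [[mY C0 mC CY] Cq]] hsame.
have [_ x0E _] := iter.
have mC' : measurable_fun setT C.
  by move=> _ B mB; rewrite setTI; apply: (@history0_measurable xi); exact: mC.
(* Monotonicity of the integral requires a nonnegative upper bound, and q may be
   negative: the bound dominates C s >= 0 for at least one s. *)
have q0 : (0 <= q * enorm (x0 - proj x0) ^+ 2)%R.
  have PrT : (0 < Pr setT)%E by rewrite probability_setT lte01.
  have [s Cs] := @filter_ex _ _ (ae_properfilter_algebraOfSetsType PrT) _ Cq.
  by have := le_trans (C0 s) Cs; rewrite lee_fin !x0E.
have -> : (\int[Pr]_s (enorm (x 1%N s - proj x0) ^+ 2)%:E = \int[Pr]_s C s)%E.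
  rewrite CY; last first.
    have := smallest_sigma_algebra setT (fun B => exists i A,
      [/\ (i < 0)%N, measurable A & B = xi i @^-1` A]).
    by move=> [H0 HC _]; rewrite -(setD0 setT); exact: HC.
  apply: ge0_ae_eq_integral => //.
  - by apply: measurable_sqr_enorm => i; exact: iterate_shift_measurable iter.
  - by move=> s _; rewrite lee_fin sqr_ge0.
  - by move=> s _; rewrite lee_fin sqr_ge0.
  - by apply: filterS hsame => s /(_ 1%N) -> _; rewrite x0E.
rewrite -[leRHS](integral_cst_probability Pr).
apply: ae_ge0_le_integral => //.
by apply: filterS Cq => s + _; rewrite x0E.
Qed.

Lemma subgradient_measurable P f G x i : unbiased_subgradient P f G ->
  edom (expected P f) x -> measurable_fun setT (fun w => G x w ord0 i).
Proof.
by move=> hG /hG[_ /(_ i)/measurable_int/measurable_EFinP].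
Qed.

(** For gradient descent the sampled subgradient is read off the step:
    gamma *: G x0 (xi 0) = (x0 - p) - (x 1 - p). *)
Lemma spg_subgradient_bound P Pr f G gamma xi x0 x p a :
  unbiased_subgradient P f G -> edom (expected P f) x0 ->
  iid Pr xi P -> 0 < gamma ->
  sfo_iterates SPG f G gamma xi x0 x ->
  (\int[Pr]_s (enorm (x 1%N s - p) ^+ 2)%:E <= a%:E)%E ->
  (\int[P]_w (enorm (G x0 w) ^+ 2)%:E
   <= (gamma ^- 2 * (2 * enorm (x0 - p) ^+ 2 + 2 * a))%:E)%E.
Proof.
move=> hG x0dom hxi gamma0 iter contr; have [_ x0E step] := iter; have [mxi _ _] := hxi.
have mG i := subgradient_measurable i hG x0dom.
have mx1 : measurable_fun setT (fun s => (enorm (x 1%N s - p) ^+ 2)%:E).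
  by apply: measurable_sqr_enorm => i; exact: iterate_shift_measurable iter.
rewrite (iid_integral 0 hxi (measurable_sqr_enorm mG)); last first.
  by move=> w; rewrite lee_fin sqr_ge0.
have bound s : enorm (G x0 (xi 0%N s)) ^+ 2
    <= gamma ^- 2 * (2 * enorm (x0 - p) ^+ 2 + 2 * enorm (x 1%N s - p) ^+ 2).
  have -> : G x0 (xi 0%N s) = gamma^-1 *: ((x0 - p) - (x 1%N s - p)).
    have -> : x 1%N s = x0 - gamma *: G x0 (xi 0%N s) by rewrite (step 0%N s) x0E.
    rewrite -addrA -opprD [p + _]addrC subrK opprB addrC subrK.
    by rewrite scalerA mulVf ?scale1r ?gt_eqF.
  by rewrite sqr_enormZ exprVn ler_pM2l ?invr_gt0 ?exprn_gt0 ?sqr_enormB_le.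
apply: (@le_trans _ _ (\int[Pr]_s ((gamma ^- 2)%:E *
   ((2 * enorm (x0 - p) ^+ 2)%:E + 2%:E * (enorm (x 1%N s - p) ^+ 2)%:E)))%E).
  apply: ge0_le_integral => //.
  - by move=> s _; rewrite lee_fin sqr_ge0.
  - exact: (measurableT_comp (measurable_sqr_enorm mG) (mxi 0%N)).
  - apply: measurable_funeM; apply: emeasurable_funD; first exact: measurable_cst.
    exact: measurable_funeM.
  - by move=> s _; rewrite -!EFinM lee_fin.
have g0 : 0 <= gamma ^- 2 by rewrite invr_ge0 exprn_ge0 ?ltW.
have mx2 : measurable_fun setT (fun s => 2%:E * (enorm (x 1%N s - p) ^+ 2)%:E)%E.
  exact: measurable_funeM.
rewrite ge0_integralZl//; last first.
- by move=> s _; rewrite adde_ge0 ?mule_ge0 ?lee_fin ?mulr_ge0 ?enorm_ge0.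
- by apply: emeasurable_funD; first exact: measurable_cst.
rewrite [leRHS]EFinM lee_wpmul2l ?lee_fin//.
rewrite ge0_integralD//; last 2 first.
- by move=> s _; rewrite lee_fin !mulr_ge0 ?enorm_ge0.
- by move=> s _; rewrite -EFinM lee_fin !mulr_ge0 ?enorm_ge0.
rewrite integral_cst_probability [X in (_ <= X)%E]EFinD. apply: leeD2l.
rewrite ge0_integralZl//; last by move=> s _; rewrite lee_fin sqr_ge0.
by rewrite EFinM lee_wpmul2l.
Qed.

(** Started at a point p which the first step does not move on average, the
    proximal point method gives x 1 = p almost surely: p is a fixed point of
    almost every proximal map, hence a critical point of almost every partial
    function. *)
Lemma spp_subgradient_eq0 P Pr f G gamma L xi p x :
  unbiased_subgradient P f G ->
  {ae P, forall w, lipschitz_gradient (f ^~ w) (L w)} ->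
  edom (expected P f) p -> iid Pr xi P ->
  sfo_iterates SPP f G gamma xi p x ->
  (\int[Pr]_s (enorm (x 1%N s - p) ^+ 2)%:E <= 0)%E ->
  {ae P, forall w, G p w = 0}.
Proof.
move=> hG Llip pdom hxi iter; have [_ x0E step] := iter.
have mG i := subgradient_measurable i hG pdom.
have [mxi _ _] := hxi; have [Gsub _ _] := hG _ pdom.
have mx1 i : measurable_fun setT (fun s => (x 1%N s - p) ord0 i).
  exact: iterate_shift_measurable iter.
move=> /(integral_sqr_enorm_eq0 Pr mx1) x1p.
apply/(integral_sqr_enorm_eq0 P mG).
rewrite (iid_integral 0 hxi (measurable_sqr_enorm mG)); last first.
  by move=> w; rewrite lee_fin sqr_ge0.
apply/(@integral_sqr_enorm_eq0 _ _ _ _ Pr (G p \o xi 0%N)).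
  by move=> i; exact: (measurableT_comp (mG i) (mxi 0%N)).
apply: filterS3 x1p (iid_ae 0 hxi Llip) (iid_ae 0 hxi Gsub).
move=> s /subr0_eq x1p lip sub.
apply: (subgradient_eq0_at_prox (gamma := gamma) lip sub).
by have := step 0%N s; rewrite /= x0E x1p.
Qed.

(** Comparing with the point p, where the partial gradients vanish, bounds
    |G x w| by L w |x - p|; the factor |x - p| is deterministic, so that only the
    second moment of L is involved. *)
Lemma lipschitz_subgradient_bound P f G L x p :
  unbiased_subgradient P f G ->
  P.-integrable setT (fun w => (L w ^+ 2)%:E) ->
  {ae P, forall w, lipschitz_gradient (f ^~ w) (L w)} ->
  edom (expected P f) x -> edom (expected P f) p ->
  {ae P, forall w, G p w = 0} ->
  (\int[P]_w (enorm (G x w) ^+ 2)%:E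
   <= (fine (\int[P]_w (L w ^+ 2)%:E) * enorm (x - p) ^+ 2)%:E)%E.
Proof.
move=> hG iL Llip xdom pdom Gp0.
have [Gx _ _] := hG _ xdom; have [Gp _ _] := hG _ pdom.
have mL := measurable_int _ iL.
rewrite EFinM fineK ?integrable_fin_num// muleC -ge0_integralZl//; last first.
- by rewrite lee_fin sqr_ge0.
- by move=> w _; rewrite lee_fin sqr_ge0.
apply: ae_ge0_le_integral => //.
- by move=> w _; rewrite lee_fin sqr_ge0.
- exact/measurable_sqr_enorm/(fun i => subgradient_measurable i hG xdom).
- by move=> w _; rewrite -EFinM lee_fin mulr_ge0 ?sqr_ge0.
- exact: measurable_funeM.
apply: filterS2 Llip (filterI Gp0 (filterI Gx Gp)).
move=> w lip [Gpw0 [Gxw Gpw]] _.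
rewrite -EFinM lee_fin mulrC -exprMn lerXn2r ?nnegrE ?enorm_ge0//.
  by rewrite mulr_ge0 ?enorm_ge0//; case: lip.
by rewrite -[G x w]subr0 -Gpw0 (lipschitz_subgradient lip).
Qed.

Lemma stochastic_bounded_gradient_of_growth P f G proj mu K : 0 < mu -> 0 <= K ->
  quadratic_growth (expected P f) proj mu ->
  (forall x, edom (expected P f) x ->
    (\int[P]_w (enorm (G x w) ^+ 2)%:E <= (K * enorm (x - proj x) ^+ 2)%:E)%E) ->
  stochastic_bounded_gradient P f G proj (K * (2 / mu)) 0.
Proof.
move=> mu0 K0 growth bound x xdom; rewrite expr0n add0e.
apply: (le_trans (bound _ xdom)).
have -> : K * enorm (x - proj x) ^+ 2
    = K * (2 / mu) * (mu / 2 * enorm (x - proj x) ^+ 2).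
  by field; rewrite gt_eqF.
rewrite EFinM lee_wpmul2l ?growth// lee_fin.
by rewrite mulr_ge0// divr_ge0// ltW.
Qed.

(** At a minimizer p of the expectation the right-hand side of the bounded
    gradient condition is zero, so G p w = 0 for almost every w; a zero
    subgradient characterizes minimizers. *)
Lemma same_minimizer_of_bounded_gradient P f G proj L p :
  unbiased_subgradient P f G -> edom (expected P f) p -> proj p = p ->
  stochastic_bounded_gradient P f G proj L 0 -> same_minimizer P f.
Proof.
move=> hG pdom pp /(_ _ pdom); have [Gsub _ [pfin _]] := hG _ pdom.
rewrite pp subee// mule0 adde0 expr0n => Gp0; exists p.
have mG i := subgradient_measurable i hG pdom.
have {Gp0}/(integral_sqr_enorm_eq0 P mG) := Gp0.
apply: filterS2 Gsub => w [ffin fsub] Gp0; split; first by rewrite ltey_eq ffin.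
move=> y; have := fsub y.
by rewrite Gp0 /dot big1 ?adde0// => i _; rewrite mxE mul0r.
Qed.

End Stochastic.

Theorem theorem2p8 (R : realType) (m : nat)
  (d : measure_display) (Om : measurableType d) (P : probability Om R)
  (f : 'rV[R]_m -> Om -> \bar R) (G : 'rV[R]_m -> Om -> 'rV[R]_m)
  (proj : 'rV[R]_m -> 'rV[R]_m)
  (d' : measure_display) (S : measurableType d') (Pr : probability S R)
  (xi : nat -> S -> Om) (meth : sfo_method) (x : 'rV[R]_m -> nat -> S -> 'rV[R]_m)
  (mu gamma q : R)
  (hf : stochastic_convex_objective P f)
  (hG : unbiased_subgradient P f G)
  (hproj : forall y, is_projection (argmin (expected P f)) y (proj y))
  (hmu : 0 < mu)
  (hgrowth : quadratic_growth (expected P f) proj mu)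
  (hsmooth : exists L : R, lipschitz_gradient (expected P f) L)
  (hsmoothSPP : meth = SPP -> partials_lipschitz_gradient P f)
  (hxi : iid Pr xi P)
  (hgamma : 0 < gamma)
  (hx : forall x0, edom (expected P f) x0 ->
          sfo_iterates meth f G gamma xi x0 (x x0))
  (hq : q < 1)
  (hlin : forall x0, edom (expected P f) x0 ->
          linear_convergence Pr xi proj q (x x0))
  (hsame : forall x0, edom (expected P f) x0 ->
          same_projection Pr proj (x x0)) :
  (exists2 L : R, 0 <= L & stochastic_bounded_gradient P f G proj L 0) /\
  ((exists2 L : R, 0 <= L & stochastic_bounded_gradient P f G proj L 0) <->
   same_minimizer P f).

Proof.
have projdom y : edom (expected P f) (proj y) by have [[]] := hproj y.
have projK y : proj (proj y) = proj y.
  by apply: is_projection_id (hproj _); have [] := hproj y.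
have contraction x0 (x0dom : edom (expected P f) x0) :=
  first_step_contraction (hx x0 x0dom) (hlin x0 x0dom) (hsame x0 x0dom).
have [K K0 bound] : exists2 K : R, 0 <= K &
    forall y, edom (expected P f) y ->
    (\int[P]_w (enorm (G y w) ^+ 2)%:E <= (K * enorm (y - proj y) ^+ 2)%:E)%E.
  case: meth hx hsmoothSPP => hx' hsmooth'.
    (* 2 a + 2 q a <= 4 a for a = |y - proj y|^2, since q < 1. *)
    exists (gamma ^- 2 * 4); first by rewrite mulr_ge0// invr_ge0 sqr_ge0.
    move=> y ydom; apply: (le_trans (spg_subgradient_bound hG ydom hxi hgamma
      (hx' _ ydom) (contraction _ ydom))).
    rewrite lee_fin -mulrA ler_pM2l ?invr_gt0 ?exprn_gt0//.
    by have := ler_piMl (sqr_ge0 (enorm (y - proj y))) (ltW hq); lra.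
  have [L [iL Llip]] := hsmooth' erefl.
  exists (fine (\int[P]_w (L w ^+ 2)%:E)).
    by rewrite fine_ge0// integral_ge0// => w _; rewrite lee_fin sqr_ge0.
  move=> y ydom.
  apply: (lipschitz_subgradient_bound hG iL Llip ydom (projdom y)).
  apply: (spp_subgradient_eq0 hG Llip (projdom y) hxi (hx' _ (projdom y))).
  (* From a minimizer the contraction bound is q * 0. *)
  have := contraction _ (projdom y).
  by rewrite projK subrr enorm0 expr0n mulr0.
have sbg := stochastic_bounded_gradient_of_growth hmu K0 hgrowth bound.
have K'0 : 0 <= K * (2 / mu) by rewrite mulr_ge0// divr_ge0// ltW.
have sbgL : exists2 L : R, 0 <= L & stochastic_bounded_gradient P f G proj L 0.
  by exists (K * (2 / mu)).
split=> //; split=> // _.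
exact: same_minimizer_of_bounded_gradient (projdom 0) (projK 0) sbg.
Qed.
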